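(* Let $X$ be a local Noetherian (affine) scheme with closed point $x_0$ and let $\mathcal{A}\subset\mathcal{B}$ be finitely generated $\mathbb{N}_0$-graded $\mathcal{O}_{X,x_0}$-algebras with $\mathcal{A}_0=\mathcal{B}_0=\mathcal{O}_{X,x_0}$. Suppose that $\bigcup_{n=1}^{\infty}\mathrm{Ass}_X(\mathcal{B}_n/\overline{\mathcal{A}_n})$ is finite and that $x_0\notin\mathrm{Ass}_X(\mathcal{B}_n/\overline{\mathcal{A}_n})$ for $n$ large enough. If $\mathcal{B}$ has deficient analytic spread, then $\mathcal{A}$ has deficient analytic spread.
   Context: $\mathcal{A}_n,\mathcal{B}_n$ are the $n$th graded pieces, and $\mathcal{A}\subset\mathcal{B}$ is an inclusion of graded algebras. $\overline{\mathcal{A}_n}$ is the integral closure of $\mathcal{A}_n$ in $\mathcal{B}_n$: all $g\in\mathcal{B}_n$ satisfying in $\mathcal{B}$ an equation $g^u+a_1g^{u-1}+\cdots+a_u=0$ with $u\ge1$ and $a_i\in\mathcal{A}_{ni}$. $\mathrm{Ass}_X(L)$ is the set of points of $X$ whose prime ideals are associated primes of the $\mathcal{O}_{X,x_0}$-module $L$. Let $\mathfrak{m}_{x_0}$ be the maximal ideal of $\mathcal{O}_{X,x_0}$. A finitely generated $\mathbb{N}_0$-graded $\mathcal{O}_{X,x_0}$-algebra $\mathcal{C}$ with $\mathcal{C}_0=\mathcal{O}_{X,x_0}$ has deficient analytic spread if the height of each minimal prime of the ideal $\mathfrak{m}_{x_0}\mathcal{C}$ of $\mathcal{C}$ is at least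 $2$. *)

(* Defs.v *)
From HB Require Import structures.
From mathcomp Require Import all_boot all_order all_algebra.
From mathcomp Require Import boolp classical_sets functions cardinality.

Set Implicit Arguments.
Unset Strict Implicit.
Unset Printing Implicit Defensive.

Import GRing.Theory.

Local Open Scope classical_set_scope.
Local Open Scope ring_scope.

Section CommutativeAlgebra.
Variable C : comNzRingType.
Implicit Types (I P Q m : set C).

(* The unit ideal is allowed, unlike in [idealr_closed]. *)
Definition ideal I : Prop :=
  I 0 /\ forall a u v, I u -> I v -> I (a * u + v).

Definition ideal_span (S : set C) : set C := smallest ideal S.

Definition noetherian_ring : Prop :=
  forall I, ideal I -> exists s : seq C, I = ideal_span [set` s].

(* [idealr_closed] includes the condition that 1 is not in [P]. *)
Definition prime_ideal P : Prop :=
  idealr_closed (mem P) /\ prime_idealr_closed (mem P).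

Definition maximal_ideal m : Prop :=
  [/\ ideal m, ~ m 1 & forall I, ideal I -> ~ I 1 -> m `<=` I -> I = m].

Definition local_ring m : Prop :=
  maximal_ideal m /\ forall m', maximal_ideal m' -> m' = m.

Definition minimal_prime I P : Prop :=
  [/\ prime_ideal P, I `<=` P
    & forall Q, prime_ideal Q -> I `<=` Q -> Q `<=` P -> Q = P].

(* Q 0 < Q 1 < ... < Q k = P, a chain of length k *)
Definition prime_chain P (k : nat) (Q : nat -> set C) : Prop :=
  [/\ forall i, (i <= k)%N -> prime_ideal (Q i),
      forall i, (i < k)%N -> Q i `<` Q i.+1
    & Q k = P].

(* The height of P is the supremum (possibly infinite) of the lengths of the
   chains of primes ending at P; it is at least h exactly when one of these
   lengths is. *)
Definition height_ge P (h : nat) : Prop :=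
  exists2 k, (h <= k)%N & exists Q : nat -> set C, prime_chain P k Q.

End CommutativeAlgebra.

(* Associated primes of the quotient module N / N', for N' a submodule of N:
   the primes that are the annihilator of the class modulo N' of some b in N. *)
Definition Ass (R : comNzRingType) (M : lmodType R) (N N' : set M) :
    set (set R) :=
  [set P | prime_ideal P /\ exists2 b, N b & P = [set r | N' (r *: b)]].

Definition finitely_generated_algebra (R : comNzRingType) (C : comAlgType R) :
    Prop :=
  exists s : seq C,
    smallest (fun S : set C => subalg_closed (mem S)) [set` s] = setT.

(* C is the internal direct sum of the R-submodules gr n, n in nat, with
   gr m * gr n contained in gr (m + n), and the structure map R -> C is an
   isomorphism onto gr 0. *)
Record graded_algebra (R : comNzRingType) (C : comAlgType R)
    (gr : nat -> set C) : Prop := GradedAlgebra {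
  graded_submod : forall n, submod_closed (mem (gr n));
  graded_mul : forall m n x y, gr m x -> gr n y -> gr (m + n)%N (x * y);
  graded_decomp : forall x, exists k (f : nat -> C),
    (forall i, gr i (f i)) /\ x = \sum_(i < k) f i;
  graded_direct : forall k (f : nat -> C), (forall i, gr i (f i)) ->
    \sum_(i < k) f i = 0 -> forall i, (i < k)%N -> f i = 0;
  graded_unit_inj : injective (GRing.in_alg C);
  graded_0 : gr 0%N = range (GRing.in_alg C)
}.

(* Integral closure of the n-th piece of A in the n-th piece of B; iota is the
   inclusion of A in B. *)
Definition graded_closure (R : comNzRingType) (A B : comAlgType R)
    (grA : nat -> set A) (grB : nat -> set B) (iota : A -> B) (n : nat) :
    set B :=
  [set g | grB n g /\
     exists (u : nat) (a : nat -> A),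
       [/\ (1 <= u)%N,
           forall i, (1 <= i <= u)%N -> grA (n * i)%N (a i)
         & g ^+ u + \sum_(1 <= i < u.+1) iota (a i) * g ^+ (u - i) = 0]].

Definition deficient_analytic_spread (R : comNzRingType) (m : set R)
    (C : comAlgType R) : Prop :=
  forall P : set C,
    minimal_prime (ideal_span (GRing.in_alg C @` m)) P -> height_ge P 2.

(* Main.v *)
(* Let P be a minimal prime of mA of height at most 1. By prime avoidance there
   is h in m outside the associated primes of the B_n / closure(A_n) other than
   m, and outside the finitely many primes of A that could separate h from P;
   so h is regular on B_n / closure(A_n) for n large, and P is minimal over hA.
   If hb = s in B with s in A, regularity makes b s^k integral over A in each
   positive degree, and the equation of integral dependence, multiplied by a
   power of h, shows that a power of s is in hA. So hB meets A inside P, and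
   some prime Q minimal over hB contracts into P, hence onto P. Then Q contains
   mB and is one of its minimal primes, so it has height at least 2, which
   contradicts Krull's principal ideal theorem. *)

Require Import Defs.
From HB Require Import structures.
From mathcomp Require Import all_boot all_order all_algebra.
From mathcomp Require Import boolp classical_sets functions cardinality.

Set Implicit Arguments.
Unset Strict Implicit.
Unset Printing Implicit Defensive.

Import GRing.Theory.

Local Open Scope classical_set_scope.
Local Open Scope ring_scope.

Lemma proper_setP (T : Type) (A B : set T) :
  A `<` B <-> A `<=` B /\ exists2 x, B x & ~ A x.
Proof.
split=> [[AB]|[AB [x Bx nAx]]]; last by split=> // /(_ x Bx).
by move=> /existsNP[x /not_implyP[Bx nAx]]; split=> //; exists x.
Qed.

(** * Ideals of Noetherian rings *)

Section Ideals.
Variable C : comNzRingType.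
Implicit Types (I J K P Q S : set C) (F : set (set C)).

Lemma idealM I a u : ideal I -> I u -> I (a * u).
Proof. by case=> I0 Ilin Iu; rewrite -[a * u]addr0; apply: Ilin. Qed.

Lemma idealMr I a u : ideal I -> I u -> I (u * a).
Proof. by rewrite mulrC; apply: idealM. Qed.

Lemma idealD I u v : ideal I -> I u -> I v -> I (u + v).
Proof. by case=> _ Ilin Iu Iv; rewrite -[u]mul1r; apply: Ilin. Qed.

Lemma idealN I u : ideal I -> I u -> I (- u).
Proof. by rewrite -mulN1r; apply: idealM. Qed.

Lemma idealB I u v : ideal I -> I u -> I v -> I (u - v).
Proof. by move=> Iid Iu /(idealN Iid); apply: idealD. Qed.

Lemma ideal1 I x : ideal I -> I 1 -> I x.
Proof. by move=> Iid; rewrite -[x]mulr1; apply: idealM. Qed.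

Lemma ideal_sum I (T : Type) (r : seq T) (p : pred T) (E : T -> C) :
  ideal I -> (forall i, p i -> I (E i)) -> I (\sum_(i <- r | p i) E i).
Proof.
by move=> Iid IE; apply: big_ind => //; [case: Iid | move=> u v; apply: idealD].
Qed.

Lemma ideal_span_ideal S : ideal (ideal_span S).
Proof.
split=> [I [[] //]|a u v Su Sv I [Iid SI]].
by apply: (proj2 Iid); [apply: Su | apply: Sv].
Qed.

Lemma sub_ideal_span S : S `<=` ideal_span S.
Proof. exact: sub_gen_smallest. Qed.

Lemma ideal_span_sub S I : ideal I -> S `<=` I -> ideal_span S `<=` I.
Proof. exact: smallest_sub. Qed.

Lemma ideal_span1P (x y : C) : ideal_span [set x] y <-> exists r, y = r * x.
Proof.
split=> [|[r ->]]; last first.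
  by apply: idealM (ideal_span_ideal _) _; apply: sub_ideal_span.
apply: (@ideal_span_sub _ [set y : C | exists r : C, y = r * x]); last first.
  by move=> _ ->; exists 1; rewrite mul1r.
split=> [|a _ _ [r ->] [r' ->]]; first by exists 0; rewrite mul0r.
by exists (a * r + r'); rewrite mulrDl mulrA.
Qed.

Definition ideal_adjoin I z : set C :=
  [set x | exists a b, I a /\ x = a + b * z].

Lemma ideal_adjoin_ideal I z : ideal I -> ideal (ideal_adjoin I z).
Proof.
move=> Iid; split; first by exists 0, 0; rewrite mul0r addr0; case: Iid.
move=> c _ _ [a [b [Ia ->]]] [a' [b' [Ia' ->]]].
exists (c * a + a'), (c * b + b'); split; first by apply: (proj2 Iid).
by rewrite mulrDr mulrDl mulrA addrACA.
Qed.

Lemma sub_ideal_adjoin I z : I `<=` ideal_adjoin I z.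
Proof. by move=> a Ia; exists a, 0; rewrite mul0r addr0. Qed.

Lemma mem_ideal_adjoin I z : ideal I -> ideal_adjoin I z z.
Proof. by case=> I0 _; exists 0, 1; rewrite mul1r add0r. Qed.

Lemma ideal_adjoin_sub I J z :
  ideal J -> I `<=` J -> J z -> ideal_adjoin I z `<=` J.
Proof.
move=> Jid IJ Jz _ [a [b [Ia ->]]].
by apply: idealD => //; [apply: IJ | apply: idealM].
Qed.

Lemma prime_idealP P :
  prime_ideal P <->
  [/\ ideal P, ~ P 1 & forall u v, P (u * v) -> P u \/ P v].
Proof.
split=> [[[P0 P1 Plin] Pmul]|[[P0 Plin] P1 Pmul]].
  split; first split; first exact: set_mem.
  - by move=> a u v Pu Pv; apply/set_mem/Plin; apply/mem_set.
  - by move=> /mem_set; apply/negP.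
  by move=> u v /mem_set/Pmul/orP[] /set_mem; [left | right].
split; first split.
- exact: mem_set.
- by apply/negP => /set_mem.
- by move=> a u v /set_mem Pu /set_mem Pv; apply/mem_set/Plin.
by move=> u v /set_mem/Pmul[] /mem_set uvP; apply/orP; [left | right].
Qed.

Lemma prime_ideal_ideal P : prime_ideal P -> ideal P.
Proof. by case/prime_idealP. Qed.

Lemma prime_ideal1 P : prime_ideal P -> ~ P 1.
Proof. by case/prime_idealP. Qed.

Lemma prime_idealM P u v : prime_ideal P -> P (u * v) -> P u \/ P v.
Proof. by case/prime_idealP => _ _; apply. Qed.

Lemma prime_idealX P u n : prime_ideal P -> P (u ^+ n) -> P u.
Proof.
move=> Ppr; elim: n => [/(prime_ideal1 Ppr) //|n IHn].
by rewrite exprS => /(prime_idealM Ppr)[].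
Qed.

Section Noetherian.
Hypothesis noethC : noetherian_ring C.

(** Otherwise choice gives a strictly increasing chain in [F]. Its union is an ideal, and the
    finitely many generators of the union already lie in one term. *)
Lemma noetherian_max F I0 :
  (forall I, F I -> ideal I) -> F I0 ->
  exists2 I, F I & forall J, F J -> I `<=` J -> J = I.
Proof.
move=> Fid FI0; apply: contrapT => nomax.
have /choice[next nextP] I : exists J, F I -> F J /\ I `<` J.
  case: (pselect (F I)) => [FI|nFI]; last by exists I.
  apply: contrapT => noJ; apply: nomax; exists I => // J FJ IJ.
  apply: contrapT => JI; apply: noJ; exists J => _; split=> //.
  by rewrite properEneq; split=> //; apply/eqP => /esym.
pose c n := iter n next I0.
have Fc n : F (c n) by elim: n => //= n /nextP[].
have c_lt n : c n `<` c n.+1 by have [] := nextP _ (Fc n).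
have c_le m n : (m <= n)%N -> c m `<=` c n.
  elim: n => [|n IHn]; first by rewrite leqn0 => /eqP ->.
  rewrite leq_eqVlt => /predU1P[-> //|/IHn cmn].
  by apply: subset_trans cmn _; apply: (properW (c_lt n)).
have [|s Us] := noethC (I := \bigcup_n c n).
  split=> [|a u v [i _ ciu] [j _ cjv]].
    by exists 0%N => //; case: (Fid _ (Fc 0%N)).
  exists (maxn i j) => //; apply: (proj2 (Fid _ (Fc _))).
    exact: c_le (leq_maxl _ _) _ ciu.
  exact: c_le (leq_maxr _ _) _ cjv.
have sU x : x \in s -> exists n, c n x.
  move=> xs; have [n _ cnx] : (\bigcup_n c n) x; last by exists n.
  by rewrite Us; apply: sub_ideal_span.
have [N sN] : exists N, forall x, x \in s -> c N x.
  elim: s {Us} sU => [|x s IHs] sU; first by exists 0%N.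
  have [|N1 sN1] := IHs; first by move=> y ys; apply: sU; rewrite inE ys orbT.
  have [N2 xN2] := sU x (mem_head _ _).
  exists (maxn N1 N2) => y; rewrite inE => /predU1P[->|/sN1].
    exact: c_le (leq_maxr _ _) _ xN2.
  exact: c_le (leq_maxl _ _) _.
have /proper_setP[_ [x cx]] := c_lt N; apply.
have : (\bigcup_n c n) x by exists N.+1.
by rewrite Us; apply: ideal_span_sub => //; apply: Fid.
Qed.

Lemma noetherian_ind (T : set C -> Prop) :
  (forall I, ideal I -> (forall J, ideal J -> I `<` J -> T J) -> T I) ->
  forall I, ideal I -> T I.
Proof.
move=> IH I Iid; apply: contrapT => nTI.
have [|//|J [Jid nTJ] Jmax] :=
  @noetherian_max [set I | ideal I /\ ~ T I] I; first by move=> ? [].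
apply: nTJ; apply: IH => // K Kid JK; apply: contrapT => nTK.
by case: (JK) => JsubK; apply; rewrite (Jmax K).
Qed.

(** Among the ideals generated by initial segments of [c] one is maximal, and it must absorb the
    next term. Hilbert's theorem uses this for leading coefficients. *)
Lemma noetherian_seq (c : nat -> C) :
  exists n, ideal_span [set c i | i in [set i | (i < n)%N]] (c n).
Proof.
pose U n := ideal_span [set c i | i in [set i | (i < n)%N]].
have [||_ [n _ <-] Umax] := @noetherian_max (range U) (U 0%N).
- by move=> _ [n _ <-]; apply: ideal_span_ideal.
- by exists 0%N.
exists n; rewrite -[X in X _](Umax (U n.+1)).
- by apply: sub_ideal_span; exists n => /=.
- by exists n.+1.
apply: ideal_span_sub; first exact: ideal_span_ideal.
by move=> _ [i /= lt_in <-]; apply: sub_ideal_span; exists i => //=; apply: ltnW.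
Qed.

(* Noetherian induction: if [I] is not prime, say [u * v] is in [I], then every
   prime above [I] contains [I + (u)] or [I + (v)]. *)
Lemma finite_primes_below I :
  ideal I -> exists s : seq (set C),
    (forall p, p \in s -> prime_ideal p /\ I `<=` p) /\
    (forall Q, prime_ideal Q -> I `<=` Q -> exists2 p, p \in s & p `<=` Q).
Proof.
move=> Iid; elim/noetherian_ind: Iid => {}I Iid IH.
case: (pselect (I 1)) => [I1|nI1].
  exists [::]; split=> // Q Qpr IQ.
  by case: (prime_ideal1 Qpr); apply: IQ.
case: (pselect (prime_ideal I)) => [Ipr|nIpr].
  exists [:: I]; split=> [p|Q _ IQ]; first by rewrite inE => /eqP ->; split.
  by exists I; rewrite ?mem_head.
have [u [v [Iuv nIu nIv]]] : exists u v, [/\ I (u * v), ~ I u & ~ I v].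
  apply: contrapT => nouv; apply/nIpr/prime_idealP; split=> // u v Iuv.
  case: (pselect (I u)) => [|nIu]; first by left.
  by right; apply: contrapT => nIv; apply: nouv; exists u, v.
have adj_lt z : ~ I z -> I `<` ideal_adjoin I z.
  move=> nIz; apply/proper_setP; split; first exact: sub_ideal_adjoin.
  by exists z => //; apply: mem_ideal_adjoin.
have [s [s_pr sP]] := IH _ (ideal_adjoin_ideal u Iid) (adj_lt _ nIu).
have [t [t_pr tP]] := IH _ (ideal_adjoin_ideal v Iid) (adj_lt _ nIv).
exists (s ++ t); split=> [p|Q Qpr IQ].
  rewrite mem_cat => /orP[/s_pr|/t_pr] [ppr Ip]; split=> //;
  exact: subset_trans (sub_ideal_adjoin _) Ip.
have Qid := prime_ideal_ideal Qpr.
have [Qu|Qv] := prime_idealM Qpr (IQ _ Iuv).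
  have [|p ps pQ] := sP Q Qpr; first exact: ideal_adjoin_sub.
  by exists p; rewrite // mem_cat ps.
have [|p pt pQ] := tP Q Qpr; first exact: ideal_adjoin_sub.
by exists p; rewrite // mem_cat pt orbT.
Qed.

(** Among the finitely many primes of [s] inside [Q], take one containing the fewest members of [s].
    A prime over [I] strictly below it would contain a member of [s] with a smaller count. *)
Lemma minimal_prime_below I Q :
  ideal I -> prime_ideal Q -> I `<=` Q ->
  exists2 P, minimal_prime I P & P `<=` Q.
Proof.
move=> Iid Qpr IQ; have [s [s_pr sP]] := finite_primes_below Iid.
pose below p := count (fun p' => `[< p' `<=` p >]) s.
have exn : exists n, `[< exists p, [/\ p \in s, p `<=` Q & below p = n] >].
  by have [p ps pQ] := sP Q Qpr IQ; exists (below p); apply/asboolP; exists p.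
case: (ex_minnP exn) => n /asboolP[p [ps pQ belowp]] nmin.
have [ppr Ip] := s_pr p ps.
exists p => //; split=> // Q' Q'pr IQ' Q'p; apply/seteqP; split=> //.
have [p' p's p'Q'] := sP Q' Q'pr IQ'.
apply: (subset_trans _ p'Q'); apply: contrapT => npp'.
have p'p : p' `<=` p by move=> x /p'Q' /Q'p.
suff : (below p' < below p)%N.
  rewrite ltnNge belowp nmin //; apply/asboolP; exists p'; split=> //.
  exact: subset_trans pQ.
rewrite /below !(permP (perm_to_rem ps)) /=.
rewrite (introF (asboolP _) npp') add0n (introT (asboolP _) (@subset_refl _ p)).
rewrite add1n ltnS; apply: sub_count => q /asboolP qp'; apply/asboolP.
exact: subset_trans p'p.
Qed.

(* An ideal maximal among those missing a multiplicative set is prime. *)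
Lemma prime_disjoint I S :
  ideal I -> S 1 -> (forall u v, S u -> S v -> S (u * v)) ->
  (forall x, S x -> ~ I x) ->
  exists2 Q, prime_ideal Q & I `<=` Q /\ forall x, S x -> ~ Q x.
Proof.
move=> Iid S1 SM SI.
pose F : set (set C) := [set J | [/\ ideal J, I `<=` J & forall x, S x -> ~ J x]].
have [||Q [Qid IQ SQ] Qmax] := @noetherian_max F I; first by move=> ? [].
  by split.
exists Q; last by split.
apply/prime_idealP; split=> //; first exact: SQ.
(* By maximality [Q + (z)] meets [S]. If [u] and [v] are outside [Q] but [u * v] is inside, the
   product of the two elements of [S] found this way falls in [Q]. *)
have adjS z : ~ Q z -> exists a b, [/\ Q a & S (a + b * z)].
  move=> nQz; apply: contrapT => noab; apply: nQz.
  rewrite -(Qmax (ideal_adjoin Q z)); [exact: mem_ideal_adjoin| |]; last first.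
    exact: sub_ideal_adjoin.
  split; first exact: ideal_adjoin_ideal.
    by apply: subset_trans IQ _; apply: sub_ideal_adjoin.
  by move=> x Sx [a [b [Qa xE]]]; apply: noab; exists a, b; rewrite -xE.
move=> u v Quv; case: (pselect (Q u)) => [|/adjS[a [b [Qa Sab]]]]; first by left.
case: (pselect (Q v)) => [|/adjS[a' [b' [Qa' Sab']]]]; first by right.
case: (SQ _ (SM _ _ Sab Sab')).
rewrite mulrDl; apply: idealD => //; first exact: idealMr.
rewrite mulrDr; apply: idealD => //; first exact: idealM.
by rewrite mulrACA; apply: idealM.
Qed.

End Noetherian.

(* If [q] is among the primes to be avoided and is contained in [p], avoiding
   [p] takes care of [q]; the other ones supply a common element outside [p]. *)
Lemma prime_avoidance I (s : seq (set C)) :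
  ideal I -> (forall p, p \in s -> prime_ideal p /\ ~ I `<=` p) ->
  exists2 h, I h & forall p, p \in s -> ~ p h.
Proof.
move=> Iid; elim: s => [_|p s IHs sP]; first by exists 0; [case: Iid|].
have [ppr nIp] := sP p (mem_head _ _).
have {IHs}[q qs|x Ix xs] := IHs; first by apply: sP; rewrite inE qs orbT.
case: (pselect (p x)) => [px|npx]; last first.
  by exists x => // q; rewrite inE => /predU1P[-> //|/xs].
have [y [Iy npy yq]] : exists y, [/\ I y, ~ p y &
    forall q, q \in s -> ~ q `<=` p -> q y].
  have {}sP q : q \in s -> prime_ideal q.
    by move=> qs; case: (sP q); rewrite // inE qs orbT.
  elim: s sP {xs} => [_|q s IHs sP].
    have /existsNP[y /not_implyP[Iy npy]] := nIp.
    by exists y.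
  have [q' q's|y [Iy npy yq]] := IHs; first by apply: sP; rewrite inE q's orbT.
  case: (pselect (q `<=` p)) => [qp|/existsNP[z /not_implyP[qz npz]]].
    by exists y; split=> // q'; rewrite inE => /predU1P[-> //|/yq].
  exists (z * y); split; first exact: idealM.
    by move=> /(prime_idealM ppr)[].
  move=> q'; rewrite inE => /predU1P[-> _|q's nq'p].
    by apply: idealMr => //; apply/prime_ideal_ideal/sP/mem_head.
  apply: idealM; last exact: yq.
  by apply/prime_ideal_ideal/sP; rewrite inE q's orbT.
(* The sum [x + y] avoids [p], hence every member of [s] inside [p]; the other members contain [y]
   but not [x]. *)
have pid := prime_ideal_ideal ppr.
have npxy : ~ p (x + y) by move=> /(idealB pid)/(_ px); rewrite addrC addKr.
exists (x + y); first exact: idealD.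
move=> q; rewrite inE => /predU1P[-> //|qs].
case: (pselect (q `<=` p)) => [qp /qp //|nqp qxy]; apply: (xs q qs).
have qid : ideal q by apply/prime_ideal_ideal; case: (sP q); rewrite // inE qs orbT.
by rewrite -(addrK y x); apply: idealB => //; apply: yq.
Qed.

End Ideals.

(** * Associated primes and Krull's principal ideal theorem *)

Lemma submod_closedP (R : comNzRingType) (M : lmodType R) (N : set M) :
  submod_closed (mem N) <->
  N 0 /\ forall (a : R) u v, N u -> N v -> N (a *: u + v).
Proof.
split=> [[N0 Nlin]|[N0 Nlin]].
  split=> [|a u v Nu Nv]; first exact: set_mem.
  by apply/set_mem/Nlin; apply: mem_set.
split=> [|a u v /set_mem Nu /set_mem Nv]; first exact: mem_set.
exact/mem_set/Nlin.
Qed.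

(** Among the annihilators of nonzero classes that contain that of [b], a maximal one is prime: if
    [u * v] kills [b'] and [v] does not, then [v *: b'] has the same annihilator as [b'], and [u] is
    in it. *)
Lemma Ass_annihilator (R : comNzRingType) (M : lmodType R) (N N' : set M) b :
  noetherian_ring R -> submod_closed (mem N) -> submod_closed (mem N') ->
  N b -> ~ N' b ->
  exists2 P, Ass N N' P & [set r | N' (r *: b)] `<=` P.
Proof.
move=> noethR /submod_closedP[N0 Nlin] /submod_closedP[N'0 N'lin] Nb nN'b.
pose ann b : set R := [set r | N' (r *: b)].
have ann_id b' : ideal (ann b').
  split=> [|a u v ub vb]; first by rewrite /ann /= scale0r.
  by rewrite /ann /= scalerDl -scalerA; apply: N'lin.
pose F : set (set R) :=
  [set I | exists b', [/\ N b', ~ N' b', I = ann b' & ann b `<=` I]].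
have [||_ [b' [Nb' nN'b' -> bb']] Imax] := @noetherian_max _ noethR F (ann b).
- by move=> _ [b' [_ _ -> _]]; apply: ann_id.
- by exists b; split.
exists (ann b') => //; split; last by exists b'.
apply/prime_idealP; split=> //; first by rewrite /ann /= scale1r.
move=> u v uvb; case: (pselect (ann b' v)) => [|nvb]; [by right | left].
have sub_ann : ann b' `<=` ann (v *: b').
  move=> r rb; rewrite /ann /= scalerA mulrC -scalerA -[_ *: _]addr0.
  exact: N'lin.
rewrite -(Imax (ann (v *: b'))) //; first by rewrite /ann /= scalerA.
exists (v *: b'); split=> //; last exact: subset_trans sub_ann.
by rewrite -[_ *: _]addr0; apply: Nlin.
Qed.

Section PrincipalIdealTheorem.
Variable C : comNzRingType.
Implicit Types (I J K P Q : set C).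

(** For [P] prime and [K] an ideal, this says that [K] is contracted from the localization at [P];
    [saturation P I] is the contraction of the extension of [I]. Such ideals of [C] stand in for
    those of the localization. *)
Definition saturated P K := forall s a, ~ P s -> K (s * a) -> K a.

Definition saturation P I : set C := [set a | exists2 s, ~ P s & I (s * a)].

Lemma saturation_ideal P I : prime_ideal P -> ideal I -> ideal (saturation P I).
Proof.
move=> Ppr Iid; split.
  by exists 1; [apply: prime_ideal1 | rewrite mulr0; case: Iid].
move=> a u v [s nPs Isu] [t nPt Itv]; exists (s * t).
  by move=> /(prime_idealM Ppr)[].
rewrite mulrDr; apply: idealD => //; last by rewrite -mulrA; apply: idealM.
by rewrite [s * t]mulrC mulrACA; apply: idealM.
Qed.

Lemma saturation_saturated P I :
  prime_ideal P -> saturated P (saturation P I).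
Proof.
move=> Ppr s a nPs [t nPt Itsa]; exists (t * s); last by rewrite -mulrA.
by move=> /(prime_idealM Ppr)[].
Qed.

Lemma sub_saturation P I : prime_ideal P -> I `<=` saturation P I.
Proof. by move=> Ppr a Ia; exists 1; [apply: prime_ideal1 | rewrite mul1r]. Qed.

Lemma saturation_sub P I J : saturated P J -> I `<=` J -> saturation P I `<=` J.
Proof. by move=> Jsat IJ a [s nPs Isa]; apply: Jsat nPs _; apply: IJ. Qed.

Hypothesis noethC : noetherian_ring C.

(* Since [P] is the only prime between [(x)] and [P], it is the annihilator of
   some [z] modulo [K]; [K + (z)] is then a simple step above [K] locally at
   [P]. *)
Lemma saturated_dcc P x K (I : nat -> set C) :
  minimal_prime (ideal_span [set x]) P -> ideal K -> K x -> saturated P K ->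
  (forall n, ideal (I n)) -> (forall n, saturated P (I n)) ->
  (forall n, I n.+1 `<=` I n) -> (forall n, K `<=` I n) ->
  exists N, forall n, (N <= n)%N -> I N `<=` I n.
Proof.
move=> [Ppr xP Pmin] Kid.
elim/(noetherian_ind noethC): Kid I => {}K Kid IH I Kx Ksat Iid Isat Idec KI.
have I_le m n : (m <= n)%N -> I n `<=` I m.
  elim: n => [|n IHn]; first by rewrite leqn0 => /eqP ->.
  rewrite leq_eqVlt => /predU1P[-> //|/IHn Inm].
  exact: subset_trans (Idec n) Inm.
case: (pselect (K 1)) => [K1|nK1].
  by exists 0%N => n _ a _; apply: KI; apply: ideal1.
(* An associated prime of [C / K] contains [x], and it lies inside [P] because [K] is saturated;
   minimality makes it equal to [P]. *)
have [z nKz PzK] : exists2 z, ~ K z & forall a, P a -> K (a * z).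
  have [||//|P' [P'pr [z _ P'E]] _] :=
      @Ass_annihilator C C^o setT K 1 noethC _ _ _ nK1.
  - exact/submod_closedP.
  - exact/submod_closedP.
  have nKz : ~ K z.
    by move=> Kz; apply: (prime_ideal1 P'pr); rewrite P'E /= scale1r.
  exists z => // a Pa; suff : P' a by rewrite P'E.
  rewrite (Pmin P') //.
    apply: ideal_span_sub; first exact: prime_ideal_ideal.
    by move=> _ ->; rewrite P'E; apply: idealMr.
  by move=> a'; rewrite P'E => Kaz; apply: contrapT => /Ksat/(_ Kaz).
pose K' := saturation P (ideal_adjoin K z).
have adj_id J : ideal J -> ideal (saturation P (ideal_adjoin J z)).
  by move=> Jid; apply: saturation_ideal => //; apply: ideal_adjoin_ideal.
have sub_adj J : J `<=` saturation P (ideal_adjoin J z).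
  by move=> a Ja; apply: sub_saturation => //; apply: sub_ideal_adjoin.
have K'K : K `<` K'.
  apply/proper_setP; split; first exact: sub_adj.
  by exists z => //; apply: sub_saturation => //; apply: mem_ideal_adjoin.
have adj_mono J J' : J `<=` J' ->
    saturation P (ideal_adjoin J z) `<=` saturation P (ideal_adjoin J' z).
  move=> JJ' a [s nPs [b [c [Jb saE]]]]; exists s => //.
  by exists b, c; split=> //; apply: JJ'.
case: (pselect (forall n, I n z)) => [Iz|/existsNP[n0 nIz]].
  apply: (IH K') => //; [exact: adj_id | exact: sub_adj | |].
    exact: saturation_saturated.
  by move=> n; apply: saturation_sub => //; apply: ideal_adjoin_sub.
(* Here [I n0] misses [z]. The saturations of [I n + (z)] stabilize by induction. In the resulting
   relation [s * a = b + c * z], the coefficient [c] must be in [P], for otherwise [z] would be in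
   [I n0]; so [c * z] is in [K]. *)
have [|||||||N IN] := IH K' _ K'K (fun n => saturation P (ideal_adjoin (I n) z)).
- exact: adj_id.
- exact: sub_adj.
- exact: saturation_saturated.
- by move=> n; apply: adj_id.
- by move=> n; apply: saturation_saturated.
- by move=> n; apply: adj_mono.
- by move=> n; apply: adj_mono.
exists (maxn n0 N) => n; rewrite geq_max => /andP[n0n Nn] a Ia.
have [s nPs [b [c [Ib saE]]]] : saturation P (ideal_adjoin (I n) z) a.
  apply: IN Nn _ _; apply: sub_adj.
  exact: I_le (leq_maxr n0 N) _ Ia.
have Icz : I (maxn n0 N) (c * z).
  rewrite -(addKr b (c * z)) -saE addrC; apply: idealB => //; first exact: idealM.
  by apply: I_le Ib; rewrite geq_max n0n.
have Pc : P c.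
  apply: contrapT => nPc; apply: nIz; apply: I_le (leq_maxl n0 N) _ _.
  exact: Isat nPc Icz.
apply: Isat nPs _; rewrite saE; apply: idealD => //.
exact/KI/PzK.
Qed.

(* The chain [J n] of contractions of the ideals generated by [y ^+ n] in the
   localization at [Q] stabilizes modulo [x] by [saturated_dcc], hence
   stabilizes by Nakayama's lemma. *)
Lemma principal_ideal_theorem x P :
  minimal_prime (ideal_span [set x]) P -> ~ height_ge P 2.
Proof.
move=> Pmin [[|[|k]] // _ [Q [Qpr Qlt Qk]]].
have [Ppr xP Pleast] := Pmin.
have Pid := prime_ideal_ideal Ppr.
have Px : P x by apply: xP; apply: sub_ideal_span.
have Qk1pr := Qpr k.+1 (leqnSn _); have Qk1id := prime_ideal_ideal Qk1pr.
have Qkpr := Qpr k (leq_trans (leqnSn _) (leqnSn _)).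
(* Only the top three primes matter: [w] separates [P] from [Q k.+1], and [y] separates [Q k.+1]
   from [Q k]. *)
have := Qlt k.+1 (ltnSn _); rewrite Qk => /proper_setP[QP [w Pw nQw]].
have /proper_setP[_ [y Qy nQy]] := Qlt k (leqnSn _).
have nQx : ~ Q k.+1 x.
  move=> Qx; apply: nQw; rewrite (Pleast (Q k.+1)) //.
  by apply: ideal_span_sub => // _ ->.
pose J n := saturation (Q k.+1) (ideal_span [set y ^+ n]).
have Jid n : ideal (J n).
  by apply: saturation_ideal => //; apply: ideal_span_ideal.
have Jsat n : saturated (Q k.+1) (J n) by apply: saturation_saturated.
have JsatP n : saturated P (J n).
  by move=> s a nPs; apply: Jsat => /QP.
have Jdec n : J n.+1 `<=` J n.
  move=> a [s nQs /ideal_span1P[r saE]]; exists s => //.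
  by apply/ideal_span1P; exists (r * y); rewrite saE exprS mulrA.
pose I n := saturation P (ideal_adjoin (J n) x).
have Iid J' : ideal J' -> ideal (saturation P (ideal_adjoin J' x)).
  by move=> J'id; apply: saturation_ideal => //; apply: ideal_adjoin_ideal.
pose K := saturation P (ideal_span [set x]).
have Kid : ideal K by apply: saturation_ideal => //; apply: ideal_span_ideal.
have [||||||N IN] := @saturated_dcc P x K I Pmin Kid.
- by apply: sub_saturation => //; apply: sub_ideal_span.
- exact: saturation_saturated.
- by move=> n; apply: Iid.
- by move=> n; apply: saturation_saturated.
- move=> n a [s nPs [b [c [Jb saE]]]]; exists s => //.
  by exists b, c; split=> //; apply: Jdec.
- move=> n; apply: saturation_sub; first exact: saturation_saturated.
  apply: subset_trans (sub_saturation Ppr).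
  apply: ideal_span_sub; first exact: ideal_adjoin_ideal.
  by move=> _ ->; apply: mem_ideal_adjoin.
(* Locally at [P], [J N] lies in [J N.+1 + x (J N)]: the coefficient [r] of [x] is in [J N] because
   [x] is not in [Q k.+1]. *)
have JI a : J N a -> exists s b r, [/\ ~ P s, J N.+1 b, J N r & s * a = b + r * x].
  move=> Ja; have [||s nPs [b [r [Jb saE]]]] := IN N.+1 _ a => //.
    by apply: sub_saturation => //; apply: sub_ideal_adjoin.
  exists s, b, r; split=> //; apply: Jsat nQx _.
  rewrite mulrC -(addKr b (r * x)) -saE addrC.
  by apply: idealB => //; [apply: idealM | apply: Jdec].
have JN a : J N a -> J N.+1 a.
  move=> Ja; apply: contrapT => nJa.
  (* Nakayama's lemma without localizing: a maximal member [L] of [F] absorbs [x (J N)], hence all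
     of [J N]. *)
  pose F : set (set C) :=
    [set L | [/\ ideal L, saturated P L, J N.+1 `<=` L, L `<=` J N & ~ J N `<=` L]].
  have [||L [Lid Lsat JL LJ nJL] Lmax] := @noetherian_max _ noethC F (J N.+1).
  - by move=> ? [].
  - by split=> // /(_ a Ja).
  apply: nJL => b Jb.
  have xJ c : J N c -> L (c * x).
    move=> Jc; apply: contrapT => nLcx.
    pose L' := saturation P (ideal_adjoin L (c * x)).
    have LL' : L `<=` L'.
      by move=> l Ll; apply: sub_saturation => //; apply: sub_ideal_adjoin.
    have L'J : L' `<=` J N.
      apply: saturation_sub => //; apply: ideal_adjoin_sub => //.
      exact: idealMr.
    have [s nPs [l [d [Ll scE]]]] : L' c.
      apply: contrapT => nL'c; apply: nLcx; rewrite -(Lmax L') //.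
        by apply: sub_saturation => //; apply: mem_ideal_adjoin.
      split=> //; first by apply: saturation_ideal => //; apply: ideal_adjoin_ideal.
      + exact: saturation_saturated.
      + exact: subset_trans LL'.
      + by move=> /(_ c Jc).
    (* Since [x] is in [P], the factor [s - d * x] stays outside [P] and can be cancelled modulo
       [L]. *)
    apply: nLcx; apply: idealMr => //; apply: (Lsat (s - d * x)).
      by move=> Psdx; apply: nPs; rewrite -(subrK (d * x) s); apply: idealD => //;
         apply: idealM.
    suff -> : (s - d * x) * c = l by [].
    by rewrite mulrBl scE mulrAC -mulrA addrK.
  have [s [d [r [nPs Jd Jr sbE]]]] := JI b Jb.
  by apply: Lsat nPs _; rewrite sbE; apply: idealD => //; [apply: JL | apply: xJ].
(* Now [(s - r * y) * y ^+ N = 0] with [y] outside [Q k], so [s - r * y] is in [Q k], and [s] is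
   forced into [Q k.+1]. *)
have [s nQs /ideal_span1P[r syE]] : J N.+1 (y ^+ N).
  by apply: JN; apply: sub_saturation => //; apply: sub_ideal_span.
have : Q k ((s - r * y) * y ^+ N).
  rewrite mulrBl syE -mulrA -exprS subrr.
  by case: (prime_ideal_ideal Qkpr).
have Qkk1 : Q k `<=` Q k.+1 by apply: properW; apply: Qlt.
move=> /(prime_idealM Qkpr)[/Qkk1 Qsry|/(prime_idealX Qkpr) //].
apply: nQs; rewrite -(subrK (r * y) s).
by apply: idealD => //; apply: idealM.
Qed.

End PrincipalIdealTheorem.

(** * Hilbert's basis theorem *)

Lemma ideal_preim (S C : comNzRingType) (f : {rmorphism S -> C}) (I : set C) :
  ideal I -> ideal (f @^-1` I).
Proof.
case=> I0 Ilin; split=> [|a u v Iu Iv]; first by rewrite /preimage /= rmorph0.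
by rewrite /preimage /= rmorphD rmorphM; apply: Ilin.
Qed.

Lemma noetherian_surj (S C : comNzRingType) (f : {rmorphism S -> C}) :
  (forall x, exists a, x = f a) -> noetherian_ring S -> noetherian_ring C.
Proof.
move=> fsurj noethS I Iid.
have [s sE] := noethS _ (ideal_preim f Iid).
exists (map f s); apply/seteqP; split; last first.
  apply: ideal_span_sub => // _ /mapP[a sa ->].
  suff : (f @^-1` I) a by [].
  by rewrite sE; apply: sub_ideal_span.
move=> x; have [a ->] := fsurj x => Ifa.
suff : f @^-1` I `<=` f @^-1` (ideal_span [set` map f s]) by apply.
rewrite sE; apply: ideal_span_sub.
  exact/ideal_preim/ideal_span_ideal.
by move=> b sb; apply: sub_ideal_span; apply: map_f.
Qed.

(* Choosing elements of [I] of minimal degree outside the ideal generated by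
   the previous ones, some leading coefficient lies in the ideal generated by
   the previous leading coefficients; cancelling it lowers the degree. *)
Lemma noetherian_poly (S : comNzRingType) :
  noetherian_ring S -> noetherian_ring {poly S}.
Proof.
move=> noethS I Iid; apply: contrapT => nofg.
have /choice[pick pickP] (s : seq {poly S}) : exists f,
    (forall g, g \in s -> I g) ->
    [/\ I f, ~ ideal_span [set` s] f &
     forall g, I g -> ~ ideal_span [set` s] g -> (size f <= size g)%N].
  case: (pselect (forall g, g \in s -> I g)) => [sI|]; last by exists 0.
  have [g [Ig nsg]] : exists g, I g /\ ~ ideal_span [set` s] g.
    apply: contrapT => nog; apply: nofg; exists s; apply/seteqP.
    split; last exact: ideal_span_sub.
    by move=> g Ig; apply: contrapT => nsg; apply: nog; exists g.
  have exn : exists n, `[< exists f, [/\ I f, ~ ideal_span [set` s] f & size f = n] >].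
    by exists (size g); apply/asboolP; exists g.
  case: (ex_minnP exn) => n /asboolP[f [If nsf <-]] nmin.
  exists f => _; split=> // h Ih nsh; apply: nmin.
  by apply/asboolP; exists h.
pose L := fix L n := if n is n'.+1 then pick (L n') :: L n' else [::].
pose f n := pick (L n).
have LI n : forall g, g \in L n -> I g.
  elim: n => // n IHn g /=; rewrite inE => /predU1P[->|/IHn //].
  by have [] := pickP _ IHn.
have fI n : I (f n) by have [] := pickP _ (LI n).
have nLf n : ~ ideal_span [set` L n] (f n) by have [] := pickP _ (LI n).
have fmin n g : I g -> ~ ideal_span [set` L n] g -> (size (f n) <= size g)%N.
  by have [_ _] := pickP _ (LI n); apply.
have fL i n : (i < n)%N -> f i \in L n.
  elim: n => // n IHn; rewrite ltnS leq_eqVlt /= inE.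
  by move=> /predU1P[->|/IHn ->]; rewrite ?eqxx ?orbT.
have f0 n : f n != 0.
  apply/eqP => fn0; apply: (nLf n); rewrite fn0.
  by case: (ideal_span_ideal [set` L n]).
have [n fn] := noetherian_seq noethS (fun n => lead_coef (f n)).
pose d := (size (f n)).-1.
have dE : size (f n) = d.+1 by rewrite /d prednK // size_poly_gt0.
(* The coefficients in degree [d] of elements of degree at most [d] in the ideal generated by [L n].
   For [i < n] the size of [f i] is at most that of [f n], so a power of ['X] shifts its leading
   coefficient into [J]. *)
pose J : set S := [set a | exists g,
  [/\ ideal_span [set` L n] g, (size g <= d.+1)%N & g`_d = a]].
have Lid := ideal_span_ideal [set` L n].
have Jid : ideal J.
  split; first by exists 0; split; [case: Lid | rewrite size_poly0 | rewrite coef0].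
  move=> a _ _ [g [Lg gd <-]] [h [Lh hd <-]].
  exists (a *: g + h); split; last by rewrite coefD coefZ.
    by rewrite -mul_polyC; apply: (proj2 Lid).
  rewrite (leq_trans (size_polyD _ _)) // geq_max hd andbT.
  exact: leq_trans (size_scale_leq _ _) gd.
have [g [Lg gd gE]] : J (lead_coef (f n)).
  move: fn; apply: ideal_span_sub => // _ [i /= lt_in <-].
  have le_fi : (size (f i) <= size (f n))%N.
    apply: fmin => // Lfn; apply: (nLf n).
    move: Lfn; apply: ideal_span_sub => // h Lih; apply: sub_ideal_span => /=.
    elim: (n) lt_in => // n' IHn'; rewrite ltnS leq_eqVlt /= inE.
    by move=> /predU1P[<-|/IHn' ->]; rewrite ?Lih ?orbT.
  have fi0 : size (f i) = (size (f i)).-1.+1 by rewrite prednK // size_poly_gt0.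
  have le_ed : ((size (f i)).-1 <= d)%N by rewrite -ltnS -fi0 -dE.
  exists ('X^(d - (size (f i)).-1) * f i); split.
  - by apply: (idealM _ Lid); apply: sub_ideal_span; apply: fL.
  - rewrite (leq_trans (size_polyMleq _ _)) // size_polyXn {2}fi0 addnS /=.
    by rewrite addSn subnK.
  - by rewrite coefXnM ltnNge leq_subr /= subKn.
have nLfg : ~ ideal_span [set` L n] (f n - g).
  by move=> Lfg; apply: (nLf n); rewrite -(subrK g (f n)); apply: (idealD Lid).
have Ifg : I (f n - g).
  apply: idealB => //; move: Lg; apply: ideal_span_sub => // h /= Lh.
  exact: LI Lh.
have := fmin n _ Ifg nLfg; rewrite leqNgt dE ltnS => /negP; apply.
apply/leq_sizeP => j; rewrite leq_eqVlt coefB => /predU1P[<-|lt_dj].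
  by rewrite gE /lead_coef subrr.
by rewrite !nth_default ?subr0 // ?dE //; apply: leq_trans gd _.
Qed.

(** Each generator [c] is absorbed by passing from [S] to [{poly S}] with ['X] sent to [c].
    Generation is phrased through subsets [D], so that no algebra structure over the changing base
    has to be carried along. *)
Lemma noetherian_adjoin (C S : comNzRingType) (f : {rmorphism S -> C})
    (s : seq C) :
  noetherian_ring S ->
  (forall D : set C, (forall a, D (f a)) -> (forall c, c \in s -> D c) ->
     (forall u v, D u -> D v -> D (u - v)) ->
     (forall u v, D u -> D v -> D (u * v)) -> forall x, D x) ->
  noetherian_ring C.
Proof.
elim: s S f => [|c s IHs] S f noethS gen.
  apply: noetherian_surj noethS.
  apply: (gen [set x | exists a, x = f a]) => //.
  - by move=> a; exists a.
  - by move=> _ _ [a ->] [b ->]; exists (a - b); rewrite rmorphB.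
  - by move=> _ _ [a ->] [b ->]; exists (a * b); rewrite rmorphM.
have cf : commr_rmorph f c by move=> a; apply: mulrC.
apply: (IHs _ (horner_morph cf) (noetherian_poly noethS)) => D Df Ds DB DM.
apply: gen => // [a|b]; first by rewrite -(horner_morphC cf); apply: Df.
rewrite inE => /predU1P[->|/Ds //].
by rewrite -[X in D X](horner_morphX cf); apply: Df.
Qed.

Lemma noetherian_algebra (R : comNzRingType) (C : comAlgType R) :
  noetherian_ring R -> finitely_generated_algebra C -> noetherian_ring C.
Proof.
move=> noethR [s sE]; apply: (@noetherian_adjoin _ _ (GRing.in_alg C) s) => //.
move=> D Dalg Ds DB DM x.
have : [set: C] x by [].
rewrite -sE; apply: smallest_sub => //; split.
- by apply/mem_set; rewrite -(rmorph1 (GRing.in_alg C)).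
- move=> a u v /set_mem Du /set_mem Dv; apply/mem_set.
  have DN w : D w -> D (- w).
    by move=> Dw; rewrite -sub0r -(rmorph0 (GRing.in_alg C)); apply: DB.
  by rewrite -[v]opprK -mulr_algl; apply: DB; [apply: DM => //; apply: Dalg | apply: DN].
- by move=> u v /set_mem Du /set_mem Dv; apply/mem_set/DM.
Qed.

(** * Graded algebras and integral closure *)

Section GradedAlgebra.
Variables (R : comNzRingType) (C : comAlgType R) (gr : nat -> set C).
Hypothesis Cgr : graded_algebra gr.

Lemma graded_piece0 n : gr n 0.
Proof. by have /submod_closedP[] := graded_submod Cgr n. Qed.

Lemma graded_lin n (a : R) u v : gr n u -> gr n v -> gr n (a *: u + v).
Proof. by have /submod_closedP[_] := graded_submod Cgr n; apply. Qed.

Lemma gradedD n u v : gr n u -> gr n v -> gr n (u + v).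
Proof. by move=> gu gv; rewrite -[u]scale1r; apply: graded_lin. Qed.

Lemma gradedB n u v : gr n u -> gr n v -> gr n (u - v).
Proof. by move=> gu gv; rewrite addrC -scaleN1r; apply: graded_lin. Qed.

Lemma graded_alg (a : R) : gr 0%N (a%:A).
Proof. by rewrite (graded_0 Cgr); exists a. Qed.

Lemma gradedX n k u : gr n u -> gr (n * k)%N (u ^+ k).
Proof.
move=> gu; elim: k => [|k IHk]; last by rewrite exprS mulnS; apply: graded_mul.
by rewrite muln0 expr0 -[1]scale1r; apply: graded_alg.
Qed.

(** The homogeneous component of degree [n]. The vanishing of [f] from [k] on fixes [f n] also when
    [n >= k]; the default 0 is never taken, since a decomposition always exists. *)
Definition gproj n x : C := xget 0 [set y | exists k (f : nat -> C),
  [/\ forall i, gr i (f i), forall i, (k <= i)%N -> f i = 0,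
      x = \sum_(i < k) f i & y = f n]].

Lemma gproj_spec n x : exists k (f : nat -> C),
  [/\ forall i, gr i (f i), forall i, (k <= i)%N -> f i = 0,
      x = \sum_(i < k) f i & gproj n x = f n].
Proof.
have [k [f [grf xE]]] := graded_decomp Cgr x.
apply: (@xgetPex _ 0 [set y | exists k (f : nat -> C),
  [/\ forall i, gr i (f i), forall i, (k <= i)%N -> f i = 0,
      x = \sum_(i < k) f i & y = f n]]).
pose f' i := if (i < k)%N then f i else 0.
exists (f' n), k, f'; split=> // [i|i|].
- by rewrite /f'; case: ifP => // _; apply: graded_piece0.
- by rewrite /f' ltnNge => ->.
- by rewrite xE; apply: eq_bigr => i _; rewrite /f' ltn_ord.
Qed.

Lemma gproj_mem n x : gr n (gproj n x).
Proof. by have [k [f [grf _ _ ->]]] := gproj_spec n x. Qed.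

Lemma sum_widen k K (f : nat -> C) : (k <= K)%N ->
  (forall i, (k <= i)%N -> f i = 0) -> \sum_(i < K) f i = \sum_(i < k) f i.
Proof.
move=> kK f0; rewrite (big_ord_widen K f kK) [LHS](bigID (fun i : 'I_K => (i < k)%N)) /=.
rewrite [X in _ + X]big1 ?addr0 // => i.
by rewrite -leqNgt => /f0.
Qed.

(** Two decompositions, padded with zeros to a common length, differ by a decomposition of 0, whose
    terms vanish. *)
Lemma gproj_sum k (f : nat -> C) n : (forall i, gr i (f i)) -> (n < k)%N ->
  gproj n (\sum_(i < k) f i) = f n.
Proof.
move=> grf nk; have [k' [f' [grf' f'0 fE ->]]] := gproj_spec n (\sum_(i < k) f i).
pose fk i := if (i < k)%N then f i else 0.
have {}fE : \sum_(i < k) fk i = \sum_(i < k') f' i.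
  by rewrite -fE; apply: eq_bigr => i _; rewrite /fk ltn_ord.
have fk0 i : (k <= i)%N -> fk i = 0 by rewrite /fk ltnNge => ->.
rewrite -(sum_widen (leq_maxl k k') fk0) -(sum_widen (leq_maxr k k') f'0) in fE.
have : \sum_(i < maxn k k') (fk i - f' i) = 0 by rewrite sumrB fE subrr.
have grfk i : gr i (fk i - f' i).
  by apply: gradedB => //; rewrite /fk; case: ifP => // _; apply: graded_piece0.
move=> /(graded_direct Cgr grfk)/(_ n (leq_trans nk (leq_maxl k k')))/subr0_eq.
by rewrite /fk nk.
Qed.

Lemma gproj_decomp x : exists k, forall K, (k <= K)%N ->
  x = \sum_(i < K) gproj i x.
Proof.
have [k [f [grf f0 xE _]]] := gproj_spec 0 x.
exists k => K kK; rewrite -(sum_widen kK f0) in xE.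
by rewrite {1}xE; apply: eq_bigr => i _; rewrite xE gproj_sum.
Qed.

Lemma gprojD n x y : gproj n (x + y) = gproj n x + gproj n y.
Proof.
have [k xE] := gproj_decomp x; have [l yE] := gproj_decomp y.
pose K := (k + l + n.+1)%N.
have kK : (k <= K)%N by rewrite /K -addnA leq_addr.
have lK : (l <= K)%N by rewrite /K addnAC leq_addl.
rewrite {1}(xE K kK) {1}(yE K lK) -big_split /=.
rewrite (gproj_sum (f := fun i => gproj i x + gproj i y)) ?ltn_addl //.
by move=> i; apply: gradedD; apply: gproj_mem.
Qed.

Lemma gproj_homog n x : gr n x -> gproj n x = x.
Proof.
move=> gx; pose f i := if i == n then x else 0.
have xE : x = \sum_(i < n.+1) f i.
  rewrite big_ord_recr /= {2}/f eqxx big1 ?add0r // => i _.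
  by rewrite /f ltn_eqF.
rewrite {1}xE gproj_sum // => [|i]; first by rewrite /f eqxx.
by rewrite /f; case: eqP => [->|_] //; apply: graded_piece0.
Qed.

Lemma gprojM d e x y : gr e y -> gproj (d + e) (x * y) = gproj d x * y.
Proof.
move=> gy; have [k xE] := gproj_decomp x.
(* Multiplication by [y] shifts degrees by [e], so the product has no component below [e]. *)
pose f j := if (e <= j)%N then gproj (j - e) x * y else 0.
have -> : x * y = \sum_(j < e + (k + d.+1)) f j.
  rewrite big_split_ord /= big1 ?add0r => [|i _]; last by rewrite /f leqNgt ltn_ord.
  rewrite {1}(xE (k + d.+1)%N) ?leq_addr // mulr_suml.
  by apply: eq_bigr => i _; rewrite /f leq_addr addKn.
rewrite gproj_sum => [|i|]; first by rewrite /f leq_addl addnK.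
  rewrite /f; case: ifP => [ei|_]; last exact: graded_piece0.
  by rewrite -{1}(subnK ei); apply: (graded_mul Cgr) => //; apply: gproj_mem.
by rewrite [(d + e)%N]addnC ltn_add2l ltn_addl.
Qed.

End GradedAlgebra.

Section GradedMorphism.
Variables (R : comNzRingType) (A B : comAlgType R).
Variables (grA : nat -> set A) (grB : nat -> set B).
Hypotheses (Agr : graded_algebra grA) (Bgr : graded_algebra grB).
Variable iota : {lrmorphism A -> B}.
Hypothesis iota_gr : forall n x, grA n x -> grB n (iota x).

Lemma gproj_morph n x : gproj grB n (iota x) = iota (gproj grA n x).
Proof.
have [k xE] := gproj_decomp Agr x.
rewrite {1}(xE (k + n.+1)%N) ?leq_addr // raddf_sum /=.
rewrite (gproj_sum Bgr (f := fun i => iota (gproj grA i x))) //.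
  by move=> i; apply: iota_gr; apply: gproj_mem.
by rewrite ltn_addl.
Qed.

(** Any monic equation of a homogeneous [g] yields one with homogeneous coefficients, by taking the
    component of degree [n * u]. This gives access to the closure properties of integral
    elements. *)
Lemma graded_closureP n g :
  graded_closure grA grB iota n g <-> grB n g /\ integralOver iota g.
Proof.
split=> [[gg [u [a [u1 _ gE]]]]|[gg [p pmon pg]]].
  split=> //; pose q := \sum_(1 <= i < u.+1) (a i)%:P * 'X^(u - i).
  have qu : (size q <= u)%N.
    rewrite /q big_nat; apply: (leq_trans (size_sum _ _ _)); apply/bigmax_leqP_seq.
    move=> i _ /andP[i1 iu]; rewrite mul_polyC.
    rewrite (leq_trans (size_scale_leq _ _)) // size_polyXn.
    by rewrite -subSn // leq_subLR; rewrite addnC -addn1 leq_add2l.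
  exists ('X^u + q).
    by rewrite monicE lead_coefDl ?lead_coefXn // size_polyXn ltnS.
  rewrite rootE rmorphD /= map_polyXn hornerD hornerXn rmorph_sum /= horner_sum.
  rewrite -[X in _ == X]gE; apply/eqP; congr (_ + _); apply: eq_bigr => i _.
  by rewrite rmorphM /= map_polyC map_polyXn hornerM hornerC hornerXn.
pose u := (size p).-1.
have pE : size p = u.+1 by rewrite prednK // size_poly_gt0 monic_neq0.
have p_u : p`_u = 1 by apply/eqP; rewrite -monicE.
have pgE : \sum_(j < u.+1) iota p`_j * g ^+ j = 0.
  rewrite -[RHS](eqP pg) horner_coef (size_map_poly_id0); last first.
    by rewrite (monicP pmon) rmorph1 oner_neq0.
  by rewrite pE; apply: eq_bigr => j _; rewrite coef_map.
(* The coefficient of [g ^+ (u - i)], cut down to the degree that makes its term homogeneous of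
   degree [n * u]. *)
pose a i := gproj grA (n * i) p`_(u - i).
have u1 : (0 < u)%N.
  rewrite lt0n; apply/eqP => u0; move: pgE.
  rewrite u0 big_ord_recl big_ord0 addr0 /= -u0 p_u u0 rmorph1 mulr1.
  by move/eqP; rewrite oner_eq0.
split=> //; exists u, a; split=> // [i _|]; first exact: gproj_mem.
have : gproj grB (n * u) (\sum_(j < u.+1) iota p`_j * g ^+ j) = 0.
  by rewrite pgE gproj_homog //; apply: graded_piece0.
rewrite (big_morph _ (@gprojD _ _ _ Bgr (n * u)%N) (gproj_homog Bgr (graded_piece0 Bgr _))).
rewrite (reindex_inj rev_ord_inj) /= big_ord_recl /= subn1 /= => sumE.
rewrite -[RHS]sumE p_u rmorph1 mul1r gproj_homog //; last exact: gradedX.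
congr (_ + _); rewrite big_add1 big_mkord; apply: eq_bigr => i _ /=.
have nuE : (n * u = n * i.+1 + n * (u - i.+1))%N.
  by rewrite -mulnDr subnKC.
rewrite subSS nuE gprojM //; last exact: gradedX.
by rewrite gproj_morph.
Qed.

(** Integral elements are closed under sums and products, and scalars of [R] are integral because
    they come from [A]. *)
Lemma graded_closure_submod n :
  submod_closed (mem (graded_closure grA grB iota n)).
Proof.
apply/submod_closedP; split=> [|a u v]; rewrite !graded_closureP.
  by split; [apply: graded_piece0 | apply: integral0].
move=> [gu intu] [gv intv]; split; first exact: graded_lin.
apply: integral_add => //; rewrite -mulr_algl -(rmorph_alg iota).
by apply: integral_mul => //; apply: integral_id.
Qed.


End GradedMorphism.

(** * Contraction of a minimal prime *)

Lemma prime_preim (S C : comNzRingType) (f : {rmorphism S -> C}) (P : set C) :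
  prime_ideal P -> prime_ideal (f @^-1` P).
Proof.
move=> /prime_idealP[Pid nP1 PM]; apply/prime_idealP; split.
- exact: ideal_preim.
- by rewrite /preimage /= rmorph1.
- by move=> u v; rewrite /preimage /= rmorphM => /PM.
Qed.

(** The annihilator of a nonzero class lies in some associated prime, so it cannot contain an [h]
    outside all of them. *)
Lemma Ass_regular (R : comNzRingType) (M : lmodType R) (N N' : set M) h b :
  noetherian_ring R -> submod_closed (mem N) -> submod_closed (mem N') ->
  (forall P, Ass N N' P -> ~ P h) -> N b -> N' (h *: b) -> N' b.
Proof.
move=> noethR Nsub N'sub nAh Nb N'hb; apply: contrapT => nN'b.
have [P AssP bP] := Ass_annihilator noethR Nsub N'sub Nb nN'b.
by apply: (nAh P) => //; apply: bP.
Qed.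

Lemma height_ge2 (C : comNzRingType) (P Q p : set C) :
  prime_ideal P -> prime_ideal Q -> prime_ideal p -> p `<` Q -> Q `<` P ->
  height_ge P 2.
Proof.
move=> Ppr Qpr ppr pQ QP; exists 2%N => //.
(* The default value [P] of [nth] is the top of the chain, at index 2. *)
by exists (nth P [:: p; Q]); split=> [[|[|[]]]|[|[]]|] //=.
Qed.

Section Contraction.
Variables (R : comNzRingType) (A B : comAlgType R).
Variables (grA : nat -> set A) (grB : nat -> set B).
Hypotheses (Agr : graded_algebra grA) (Bgr : graded_algebra grB).
Variables (iota : {lrmorphism A -> B}) (h : R) (N : nat) (P : set A).
Hypotheses (iota_inj : injective iota).
Hypothesis iota_gr : forall n x, grA n x -> grB n (iota x).
Hypothesis h_reg : forall n b, (N <= n)%N -> grB n b ->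
  graded_closure grA grB iota n (h *: b) -> graded_closure grA grB iota n b.
Hypotheses (Ppr : prime_ideal P) (Ph : P h%:A).

(* If [h b = s] with [s] homogeneous of positive degree, then [b s^N] is
   integral; multiplying its equation by a power of [h] puts a power of [s] in
   [h A]. *)
Lemma contraction_sub s b : h *: b = iota s -> P s.
Proof.
have Pid := prime_ideal_ideal Ppr.
have PhZ a : P (h *: a) by rewrite -mulr_algl; apply: idealMr.
move=> hbs; have [k sE] := gproj_decomp Agr s.
rewrite (sE k) //; apply: ideal_sum => // i _; move: (i : nat) => {sE}{}i.
have {hbs} : h *: gproj grB i b = iota (gproj grA i s).
  rewrite -(gproj_morph Agr Bgr iota_gr) -hbs -mulr_algl mulrC.
  by rewrite -(gprojM Bgr i b (graded_alg Bgr h)) addn0 mulrC mulr_algl.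
have := gproj_mem Agr i s; have := gproj_mem Bgr i b.
move: (gproj grA i s) (gproj grB i b) => {}s {}b.
(* Degree 0 is treated apart, as powers do not raise it: there [s] and [b] are scalars [c] and [d],
   and [c = h * d] already in [R]. *)
case: i => [|i] gb gs hbs.
  move: gs gb hbs; rewrite (graded_0 Agr) (graded_0 Bgr) => -[c _ <-] [d _ <-] /=.
  rewrite rmorph_alg scalerA => /(graded_unit_inj Bgr) <-.
  by rewrite -scalerA; apply: PhZ.
apply: (@prime_idealX _ _ _ N.+1) => //.
(* The exponent [N.+1] brings [c] to a degree at least [N], where [h_reg] applies; [h *: c] is
   integral because it equals [iota t]. *)
pose t := s ^+ N.+1; pose c := b * iota s ^+ N.
have gc : grB (i.+1 * N.+1)%N c.
  by rewrite mulnS; apply: (graded_mul Bgr) => //; apply: gradedX => //; apply: iota_gr.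
have hc : h *: c = iota t by rewrite /c scalerAl hbs -exprS -rmorphXn.
have [||_ [u [a [u1 _ cE]]]] := @h_reg (i.+1 * N.+1)%N c _ gc.
- by rewrite mulSn (leq_trans (leqnSn N)) // leq_addr.
- apply/(graded_closureP Agr Bgr iota_gr); rewrite hc; split.
    by apply: iota_gr; apply: gradedX.
  exact: integral_id.
apply: (@prime_idealX _ _ _ u) => //; rewrite -/t.
(* The equation of [c] times [h ^+ u], with [h *: c] replaced by [iota t]; each term of the sum
   keeps a factor [h ^+ j] with [j] positive. *)
suff -> : t ^+ u = - \sum_(1 <= j < u.+1) h ^+ j *: (a j * t ^+ (u - j)).
  apply: idealN => //; rewrite big_nat; apply: ideal_sum => // -[//|j] _.
  by rewrite exprS -scalerA; apply: PhZ.
apply/iota_inj/eqP; rewrite rmorphN -addr_eq0 rmorphXn /= -hc exprZn.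
move/(congr1 ( *:%R (h ^+ u))): cE; rewrite scalerDr scaler0 => cE.
rewrite -[eqbRHS]cE; apply/eqP; congr (_ + _).
rewrite raddf_sum scaler_sumr big_nat [RHS]big_nat; apply: eq_bigr => j /andP[_ ju].
rewrite /= linearZ rmorphM rmorphXn /= -hc exprZn -scalerAr scalerA -exprD.
by rewrite subnKC.
Qed.

End Contraction.

Theorem theorem8p3 (R : comNzRingType) (m : set R)
  (R_noeth : noetherian_ring R) (R_local : local_ring m)
  (A B : comAlgType R) (grA : nat -> set A) (grB : nat -> set B)
  (A_graded : graded_algebra grA) (B_graded : graded_algebra grB)
  (A_fg : finitely_generated_algebra A) (B_fg : finitely_generated_algebra B)
  (iota : {lrmorphism A -> B}) (iota_inj : injective iota)
  (iota_graded : forall n x, grA n x -> grB n (iota x))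
  (Ass_finite : finite_set
    (\bigcup_(n in [set n | (1 <= n)%N])
       Ass (grB n) (graded_closure grA grB iota n)))
  (Ass_closed_point : exists N : nat, forall n, (N <= n)%N ->
    ~ Ass (grB n) (graded_closure grA grB iota n) m)
  (B_das : deficient_analytic_spread m B) :
  deficient_analytic_spread m A.
Proof.
move=> P [Ppr mP Pmin]; apply: contrapT => htP.
have A_noeth := noetherian_algebra R_noeth A_fg.
have B_noeth := noetherian_algebra R_noeth B_fg.
have [[mid m1 m_max] _] := R_local.
have [N mNAss] := Ass_closed_point.
have [sF sFE] := (finite_seqP _).1 Ass_finite.
have zero_id : ideal [set (0 : A)].
  by split=> // a _ _ -> ->; rewrite mulr0 addr0.
(* Every prime of [A] contains one of the finitely many primes in [sA], so a prime with no other
   prime below it belongs to [sA]. *)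
have [sA [sA_pr sAP]] := finite_primes_below A_noeth zero_id.
pose mA := ideal_span (GRing.in_alg A @` m).
pose sR := [seq p <- sF | p != m] ++
  [seq GRing.in_alg A @^-1` p | p <- sA & `[< ~ mA `<=` p >]].
have [p|h mh sRh] := @prime_avoidance _ m sR mid.
  rewrite mem_cat => /orP[|/mapP[q]]; rewrite mem_filter.
    move=> /andP[/eqP pm psF].
    have [n _ [ppr _]] : (\bigcup_(n in [set n | (1 <= n)%N])
        Ass (grB n) (graded_closure grA grB iota n)) p by rewrite sFE.
    split=> // mp; apply: pm; apply: m_max => //.
      exact: prime_ideal_ideal.
    exact: prime_ideal1.
  move=> /andP[/asboolP nmq /sA_pr[qpr _]] ->; split; first exact: prime_preim.
  move=> mq; apply: nmq; apply: ideal_span_sub; first exact: prime_ideal_ideal.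
  by move=> _ [r mr <-]; apply: mq.
(* The bound [N.+1] excludes [m] as an associated prime and also makes [n] positive, so that the
   associated primes are listed in [sF]. *)
have h_reg n b : (N.+1 <= n)%N -> grB n b ->
    graded_closure grA grB iota n (h *: b) -> graded_closure grA grB iota n b.
  move=> Nn; apply: Ass_regular => //.
  - exact: (graded_submod B_graded).
  - exact: graded_closure_submod.
  move=> p pAss ph; apply: (sRh p) => //; rewrite mem_cat mem_filter.
  apply/orP; left; apply/andP; split.
    apply/eqP => pm; apply: (mNAss n); first exact: ltnW.
    by rewrite -pm.
  suff : [set` sF] p by [].
  by rewrite -sFE; exists n => //=; apply: leq_trans Nn.
have mAh : mA h%:A by apply: sub_ideal_span; exists h.
(* If [Q] is strictly below [P], the height bound on [P] forces [Q] into [sA]. By minimality of [P],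
   [Q] does not contain [mA], so [h] was chosen outside its contraction. *)
have Pminh Q : prime_ideal Q -> Q h%:A -> Q `<=` P -> Q = P.
  move=> Qpr Qh QP; apply: contrapT => nQP.
  have [|p psA pQ] := sAP Q Qpr.
    by move=> _ ->; case: (prime_ideal_ideal Qpr).
  have [ppr _] := sA_pr p psA.
  have pEQ : p = Q.
    apply: contrapT => npQ; apply: htP; apply: (@height_ge2 _ P Q p) => //.
      by rewrite properEneq; split=> //; apply/eqP.
    by rewrite properEneq; split=> //; apply/eqP.
  apply: (sRh (GRing.in_alg A @^-1` Q)) => //.
  rewrite mem_cat; apply/orP; right; apply: map_f; rewrite mem_filter -pEQ psA andbT.
  by apply/asboolP => mp; apply: nQP; apply: Pmin => //; rewrite -pEQ.
(* The image of the complement of [P] is multiplicative, and [contraction_sub] says that it misses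
   [hB]. *)
have [|||x [s nPs <-] /ideal_span1P[r rE]|Q0 Q0pr [hQ0 SQ0]] :=
    @prime_disjoint B B_noeth (ideal_span [set h%:A]) (iota @` (~` P)).
- exact: ideal_span_ideal.
- by exists 1; [apply: prime_ideal1 | rewrite rmorph1].
- move=> _ _ [s nPs <-] [t nPt <-]; exists (s * t); last by rewrite rmorphM.
  by move=> /(prime_idealM Ppr)[].
- apply: nPs; apply: (contraction_sub A_graded B_graded iota_inj iota_graded h_reg Ppr).
    exact: mP.
  by rewrite rE mulrC mulr_algl.
have [Q Qmin QQ0] := minimal_prime_below B_noeth (ideal_span_ideal _) Q0pr hQ0.
apply: (principal_ideal_theorem B_noeth Qmin); apply: B_das.
have [Qpr hQ Qleast] := Qmin.
have QE : iota @^-1` Q = P.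
  apply: Pminh; first exact: prime_preim.
    by rewrite /preimage /= rmorph_alg; apply: hQ; apply: sub_ideal_span.
  by move=> s Qs; apply: contrapT => nPs; apply: (SQ0 (iota s)); [exists s | apply: QQ0].
(* A prime inside [Q] that contains [mB] also contains [h], so minimality over [h] passes to
   minimality over [mB]. *)
split=> // [|Q' Q'pr mQ' Q'Q].
  apply: ideal_span_sub; first exact: prime_ideal_ideal.
  move=> _ [r mr <-]; suff : (iota @^-1` Q) r%:A by rewrite /preimage /= rmorph_alg.
  by rewrite QE; apply: mP; apply: sub_ideal_span; exists r.
apply: Qleast => //; apply: ideal_span_sub; first exact: prime_ideal_ideal.
by move=> _ ->; apply: mQ'; apply: sub_ideal_span; exists h.
Qed.
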